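(* Every local derivation of the Block-type Lie algebra $\mathcal B$ is a derivation. Equivalently, $\operatorname{LDer}(\mathcal B)=\operatorname{Der}(\mathcal B)$.
   Context: $\mathcal B$ is the complex Lie algebra with basis $\{L_{\alpha,i}\mid \alpha\in\mathbb Z,\ i\in\mathbb Z_{\geq 0}\}$ and bracket $[L_{\alpha,i},L_{\beta,j}]=\bigl(\beta(i+1)-\alpha(j+1)\bigr)L_{\alpha+\beta,i+j}$ for $\alpha,\beta\in\mathbb Z$, $i,j\in\mathbb Z_{\geq 0}$. $\operatorname{Der}(\mathcal B)$ is the set of derivations of $\mathcal B$, i.e. linear maps $D:\mathcal B\to\mathcal B$ with $D([x,y])=[D(x),y]+[x,D(y)]$ for all $x,y$. A linear map $\Delta:\mathcal B\to\mathcal B$ is a local derivation if for every $x\in\mathcal B$ there is $D_x\in\operatorname{Der}(\mathcal B)$ (depending on $x$) with $\Delta(x)=D_x(x)$; $\operatorname{LDer}(\mathcal B)$ is the set of all local derivations. *)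

(* Defs.v *)
From HB Require Import structures.
From mathcomp Require Import all_boot all_order all_algebra.
From mathcomp Require Import finmap.
From mathcomp Require Import classical_sets reals.
From mathcomp Require Import complex.
From mathcomp Require Import monalg ring.

Set Implicit Arguments.
Unset Strict Implicit.
Unset Printing Implicit Defensive.

Import GRing.Theory Num.Theory.
Local Open Scope classical_set_scope.
Local Open Scope ring_scope.

(* The complex field is R[i], for R the real numbers.  The underlying vector
   space of the Block-type Lie algebra is the space of finitely supported
   functions int * nat -> R[i], whose canonical basis plays the role of the
   L_{alpha,i}.  (No product on {malg _[_]} is involved: int * nat is used only
   as an index set.) *)
Definition block (R : realType) := {malg R[i][(int * nat)%type]}.

Definition blockL (R : realType) (a : int) (i : nat) : block R := << (a, i) >>.
Arguments blockL {R}.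

Definition bracketL (R : realType) (p q : int * nat) : block R :=
  (q.1 * p.2.+1%:Z - p.1 * q.2.+1%:Z)%:~R *: blockL (p.1 + q.1) (p.2 + q.2)%N.
Arguments bracketL {R}.

(* bilinear extension of bracketL *)
HB.lock Definition bracket (R : realType) (x y : block R) : block R :=
  \sum_(p <- msupp x) \sum_(q <- msupp y) (x@_p * y@_q) *: bracketL p q.
Arguments bracket {R}.

Section Block.
Variable R : realType.
Local Notation B := (block R).
Implicit Types x y z : B.

Definition Der : set {linear B -> B} :=
  [set D | forall x y, D (bracket x y) = bracket (D x) y + bracket x (D y)].

Definition LDer : set {linear B -> B} :=
  [set Delta | forall x, exists2 D, Der D & Delta x = D x].

Lemma bracketEw (d1 d2 : {fset (int * nat)%type}) x y :
    (msupp x `<=` d1)%fset -> (msupp y `<=` d2)%fset ->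
  bracket x y = \sum_(p <- d1) \sum_(q <- d2) (x@_p * y@_q) *: bracketL p q.
Proof.
move=> sx sy; rewrite unlock.
rewrite (big_fset_incl _ sx) => [|p _ /mcoeff_outdom xp0]; last first.
  by apply: big1 => q _; rewrite xp0 mul0r scale0r.
apply: eq_bigr => p _.
by apply: (big_fset_incl _ sy) => q _ /mcoeff_outdom yq0; rewrite yq0 mulr0 scale0r.
Qed.

Lemma bracketLC p q : bracketL p q = - bracketL q p :> B.
Proof.
by rewrite /bracketL -scaleNr -rmorphN opprB (addrC q.1) (addnC q.2).
Qed.

Lemma bracketC x y : bracket x y = - bracket y x.
Proof.
rewrite unlock exchange_big -sumrN; apply: eq_bigr => q _ /=.
rewrite -sumrN; apply: eq_bigr => p _ /=.
by rewrite bracketLC scalerN mulrC.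
Qed.

Lemma bracketPl (c : R[i]) x1 x2 y :
  bracket (c *: x1 + x2) y = c *: bracket x1 y + bracket x2 y.
Proof.
set d := (msupp (c *: x1 + x2) `|` msupp x1 `|` msupp x2)%fset.
have sd : (msupp (c *: x1 + x2) `<=` d)%fset by rewrite /d -fsetUA fsubsetUl.
have sd1 : (msupp x1 `<=` d)%fset by rewrite /d fsubsetU // fsubsetUr.
have sd2 : (msupp x2 `<=` d)%fset by rewrite /d fsubsetUr.
rewrite !(@bracketEw d (msupp y)) //.
rewrite scaler_sumr -big_split; apply: eq_bigr => p _ /=.
rewrite scaler_sumr -big_split; apply: eq_bigr => q _ /=.
by rewrite mcoeffD mcoeffZ mulrDl scalerDl scalerA mulrA.
Qed.

Lemma bracketPr (c : R[i]) x y1 y2 :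
  bracket x (c *: y1 + y2) = c *: bracket x y1 + bracket x y2.
Proof. by rewrite bracketC bracketPl opprD -scalerN -!bracketC. Qed.

Lemma bracket_blockL (a b : int) (i j : nat) :
  bracket (blockL a i) (blockL b j) =
    (b * i.+1%:Z - a * j.+1%:Z)%:~R *: blockL (a + b) (i + j)%N :> B.
Proof.
rewrite unlock /blockL !msuppU oner_eq0 !big_seq_fset1 !mcoeffUU mulr1.
by rewrite scale1r.
Qed.

Lemma blockE x : x = \sum_(p <- msupp x) x@_p *: blockL p.1 p.2.
Proof.
rewrite [LHS]monalgE; apply: eq_bigr => -[a i] _ /=; apply/malgP => k.
by rewrite mcoeffZ [in RHS]mcoeffU mulrnAr mulr1 mcoeffU.
Qed.

Lemma block_ind (P : B -> Prop) :
  P 0 -> (forall c x y, P x -> P y -> P (c *: x + y)) ->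
  (forall a i, P (blockL a i)) -> forall x, P x.
Proof.
move=> P0 PD PL x; rewrite [x]blockE.
by elim/big_rec: _ => // p y _ Py; apply: PD.
Qed.

Lemma bracket0l y : bracket 0 y = 0.
Proof. by rewrite unlock msupp0 big_seq_fset0. Qed.

Lemma bracket0r x : bracket x 0 = 0.
Proof. by rewrite bracketC bracket0l oppr0. Qed.

Lemma bracketZl (c : R[i]) x y : bracket (c *: x) y = c *: bracket x y.
Proof. by rewrite -[c *: x]addr0 bracketPl bracket0l addr0. Qed.

Lemma bracketZr (c : R[i]) x y : bracket x (c *: y) = c *: bracket x y.
Proof. by rewrite -[c *: y]addr0 bracketPr bracket0r addr0. Qed.

Lemma bracketxx x : bracket x x = 0.
Proof.
have /eqP := bracketC x x.
rewrite -addr_eq0 -mulr2n -scaler_nat scaler_eq0 pnatr_eq0 /=.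
by move/eqP.
Qed.

Lemma bracket_jacobi x y z :
  bracket x (bracket y z) = bracket (bracket x y) z + bracket y (bracket x z).
Proof.
pose J (u v w : B) :=
  bracket u (bracket v w) = bracket (bracket u v) w + bracket v (bracket u w).
have Jl c u u' v w : J u v w -> J u' v w -> J (c *: u + u') v w.
  rewrite /J => Ju Ju'.
  by rewrite !(bracketPl, bracketPr) Ju Ju' scalerDr addrACA.
have Jm c u v v' w : J u v w -> J u v' w -> J u (c *: v + v') w.
  rewrite /J => Jv Jv'.
  by rewrite !(bracketPl, bracketPr) Jv Jv' scalerDr addrACA.
have Jr c u v w w' : J u v w -> J u v w' -> J u v (c *: w + w').
  rewrite /J => Jw Jw'.
  by rewrite !bracketPr Jw Jw' scalerDr addrACA.
have J0l v w : J 0 v w by rewrite /J !(bracket0l, bracket0r) addr0.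
have J0m u w : J u 0 w by rewrite /J !(bracket0l, bracket0r) addr0.
have J0r u v : J u v 0 by rewrite /J !bracket0r addr0.
suff JL a i b j d k : J (blockL a i) (blockL b j) (blockL d k : B).
  apply: (@block_ind (fun u => J u y z)) => [//|c u u' ? ?|a i]; first exact: Jl.
  apply: (@block_ind (fun v => J _ v z)) => [//|c u u' ? ?|b j]; first exact: Jm.
  by apply: (@block_ind (J _ _)) => [//|c u u' ? ?|d k]; [exact: Jr | exact: JL].
rewrite {Jl Jm Jr J0l J0m J0r}/J.
rewrite !bracket_blockL !(bracketZl, bracketZr) !bracket_blockL !scalerA.
rewrite !addrA !addnA [b + a]addrC [(j + i)%N]addnC -scalerDl -!rmorphM -rmorphD.
congr (_%:~R *: _) => /=.
rewrite -!(addn1 i) -!(addn1 j) -!(addn1 k) -!(addn1 (_ + _)%N) !PoszD.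
ring.
Qed.

End Block.

Arguments Der : clear implicits.
Arguments LDer : clear implicits.

(* Main.v *)
From HB Require Import structures.
Require Import Defs.
From mathcomp Require Import all_boot all_order all_algebra.
From mathcomp Require Import finmap.
From mathcomp Require Import classical_sets reals.
From mathcomp Require Import complex.
From mathcomp Require Import monalg.
From mathcomp Require Import ring zify.

(** Write [L_(a, i)] for the basis vectors, [E] for the derivation multiplying
    [L_(a, i)] by [i], and [omega] for the structure constants of the bracket.

    The derivations are exactly the maps [ad u + c E] ([Der_ad_euler],
    [ad_euler_Der]).  Indeed, a component of nonzero degree [(a, b)] of a
    derivation is a multiple of [ad L_(a, b)], or zero if [b < 0], and that of
    degree [(0, 0)] multiplies [L_(c, j)] by a linear function of [(c, j)].  So a local derivation
    [Delta] is a linear map such that every [Delta x] has the form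
    [[u, x] + c E x], where [u] and [c] depend on [x]; what must be shown is that
    they can be chosen independently of [x].

    In degree [(a, b) <> (0, 0)], [Delta] is evaluated on [X + s Y] for two basis
    vectors and a scalar [s].  When [X] is of much higher level than [Y] and its
    first index is larger still, the finiteness of the support of [u] forces the
    component of [Delta] to be proportional to [ad L_(a, b)] on the pair [X, Y]
    ([local_component_ratio]).  Two arbitrary basis vectors are compared through
    a common [X], so the whole component is a multiple of [ad L_(a, b)]
    ([local_component]); the multipliers are the coefficients of one element
    [v], and [Delta - ad v] is diagonal in the basis
    ([local_up_to_diagonal]).

    The diagonal entries [phi c j] are then shown to be linear in [(c, j)].  Sums
    of two basis vectors with proportional indices show that [phi] is linear on
    level [0] and on the diagonal ([phi_level0], [phi_diagonal]); once it vanishes on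
    level [0], sums of four basis vectors show that it is constant on each other
    level ([phi_level_const]). *)

Set Implicit Arguments.
Unset Strict Implicit.
Unset Printing Implicit Defensive.

Import Order.TTheory GRing.Theory Num.Theory.
Local Open Scope ring_scope.

(** * Coefficients and the derivations [ad u + c E] *)

(** The structure constant of the bracket of the basis vectors at [(a, b)] and
    [(c, d)].  It is the determinant of [(a, b + 1)] and [(c, d + 1)], whence its
    affine behaviour along lines. *)
Definition omega (a b c d : int) : int := c * (b + 1) - a * (d + 1).

(** The second index is an integer, with value [0] below the range of the basis:
    positions can then be translated freely, without natural subtraction. *)
HB.lock Definition coefz (R : realType) (x : block R) (a b : int) : R[i] :=
  if b is Posz n then x@_(a, n) else 0.
Arguments coefz {R}.

HB.lock Definition euler (R : realType) (x : block R) : block R :=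
  [malg p in msupp x => p.2%:R * x@_p].
Arguments euler {R}.

(** The general derivation, see [Der_ad_euler]. *)
HB.lock Definition ad_euler (R : realType) (u : block R) (c : R[i])
    (x : block R) : block R :=
  bracket u x + c *: euler x.
Arguments ad_euler {R}.

Section Coefficients.
Variable R : realType.
Local Notation B := (block R).
Implicit Types (x y u : B) (a b : int).

Lemma coefz_nat x a (n : nat) : coefz x a n = x@_(a, n).
Proof. by rewrite unlock. Qed.

Lemma coefz_neg x a b : b < 0 -> coefz x a b = 0.
Proof. by rewrite unlock; case: b. Qed.

Lemma coefz_ext x y : (forall a (n : nat), coefz x a n = coefz y a n) -> x = y.
Proof. by move=> exy; apply/malgP => -[a n]; rewrite -!coefz_nat; exact: exy. Qed.

Lemma coefz0 a b : coefz (0 : B) a b = 0.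
Proof. by rewrite unlock; case: b => // n; rewrite mcoeff0. Qed.

Lemma coefzD x y a b : coefz (x + y) a b = coefz x a b + coefz y a b.
Proof. by rewrite unlock; case: b => [n|n] /=; rewrite ?mcoeffD ?addr0. Qed.

Lemma coefzZ c x a b : coefz (c *: x) a b = c * coefz x a b.
Proof. by rewrite unlock; case: b => [n|n] /=; rewrite ?mcoeffZ ?mulr0. Qed.

Lemma coefzP c x y a b : coefz (c *: x + y) a b = c * coefz x a b + coefz y a b.
Proof. by rewrite coefzD coefzZ. Qed.

Lemma coefzB x y a b : coefz (x - y) a b = coefz x a b - coefz y a b.
Proof. by rewrite -scaleN1r coefzD coefzZ mulN1r. Qed.

Lemma coefzL c (j : nat) a b :
  coefz (blockL c j : B) a b = ((c == a) && (j%:Z == b))%:R.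
Proof.
rewrite unlock; case: b => [n|n] /=; last by rewrite andbF.
by rewrite /blockL mcoeffU xpair_eqE eqz_nat.
Qed.

Lemma coefz_bound x : exists K : nat, forall a b, coefz x a b != 0 ->
  (`|a| <= K)%N /\ (`|b| <= K)%N.
Proof.
exists (\sum_(p <- msupp x) (`|p.1| + p.2))%N => a [n|n]; last first.
  by rewrite coefz_neg ?eqxx.
rewrite coefz_nat mcoeff_neq0 => xs; rewrite (big_fsetD1 _ xs) /=; lia.
Qed.

Lemma coefz_bracketL u c (j : nat) a b :
  coefz (bracket u (blockL c j)) a b
    = coefz u (a - c) (b - j%:Z) * (omega (a - c) (b - j%:Z) c j)%:~R.
Proof.
elim/block_ind: u => [|k x y IHx IHy|d i].
- by rewrite bracket0l !coefz0 mul0r.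
- by rewrite bracketPl 2!coefzP IHx IHy mulrDl mulrA.
rewrite bracket_blockL coefzZ !coefzL.
have -> : (d + c == a) = (d == a - c) by lia.
have -> : ((i + j)%:Z == b) = (i%:Z == b - j%:Z) by lia.
have [<-|] := eqVneq d; last by rewrite !(mulr0, mul0r).
have [<-|] := eqVneq i%:Z; last by rewrite andbF !(mulr0, mul0r).
rewrite mulr1 mul1r; congr _%:~R; rewrite /omega; lia.
Qed.

Lemma coefz_euler x a b : coefz (euler x) a b = b%:~R * coefz x a b.
Proof.
case: b => [n|n]; last by rewrite !coefz_neg ?mulr0.
rewrite !coefz_nat euler.unlock mcoeffE -[_ \in _]mcoeff_neq0.
by case: eqVneq => //= ->; rewrite mulr0.
Qed.

Lemma eulerP c x y : euler (c *: x + y) = c *: euler x + euler y.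
Proof.
by apply: coefz_ext => a n; rewrite !(coefzD, coefzZ, coefz_euler) mulrDr mulrCA.
Qed.

Lemma euler0 : euler (0 : B) = 0.
Proof. by apply: coefz_ext => a n; rewrite coefz_euler coefz0 mulr0. Qed.

Lemma eulerZ c x : euler (c *: x) = c *: euler x.
Proof. by rewrite -[c *: x]addr0 eulerP euler0 addr0. Qed.

Lemma euler_blockL a i : euler (blockL a i : B) = i%:R *: blockL a i.
Proof.
apply: coefz_ext => c j; rewrite coefz_euler coefzZ coefzL eqz_nat.
by have [->|] := eqVneq i j; rewrite ?andbF ?mulr0.
Qed.

Lemma euler_bracket x y :
  euler (bracket x y) = bracket (euler x) y + bracket x (euler y).
Proof.
elim/block_ind: x => [|c x x' IHx IHx'|a i].
- by rewrite !(bracket0l, euler0) addr0.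
- by rewrite !(bracketPl, eulerP) IHx IHx' scalerDr addrACA.
elim/block_ind: y => [|c y y' IHy IHy'|b j].
- by rewrite !(bracket0r, euler0) addr0.
- by rewrite !(bracketPr, eulerP) IHy IHy' scalerDr addrACA.
rewrite !euler_blockL bracketZl bracketZr -scalerDl -natrD bracket_blockL.
by rewrite eulerZ euler_blockL !scalerA mulrC.
Qed.

Lemma ad_eulerE u c x : ad_euler u c x = bracket u x + c *: euler x.
Proof. by rewrite unlock. Qed.

Lemma ad_eulerP u c k x y :
  ad_euler u c (k *: x + y) = k *: ad_euler u c x + ad_euler u c y.
Proof.
rewrite !ad_eulerE bracketPr eulerP !scalerDr !scalerA [c * k]mulrC.
by rewrite addrACA.
Qed.

Lemma ad_euler0 u c : ad_euler u c 0 = 0.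
Proof. by rewrite ad_eulerE bracket0r euler0 scaler0 addr0. Qed.

Lemma ad_eulerD u c x y : ad_euler u c (x + y) = ad_euler u c x + ad_euler u c y.
Proof. by rewrite -[x in LHS]scale1r ad_eulerP scale1r. Qed.

Lemma coefz_ad_eulerL u c d (j : nat) a b :
  coefz (ad_euler u c (blockL d j)) a b
  = coefz u (a - d) (b - j%:Z) * (omega (a - d) (b - j%:Z) d j)%:~R
    + c * (b%:~R * ((d == a) && (j%:Z == b))%:R).
Proof. by rewrite ad_eulerE coefzD coefzZ coefz_bracketL coefz_euler coefzL. Qed.

Lemma ad_euler_Der (D : {linear B -> B}) u c :
  (forall x, D x = ad_euler u c x) -> Der R D.
Proof.
move=> ED x y; rewrite !ED !ad_eulerE bracket_jacobi euler_bracket scalerDr.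
rewrite -[bracket u x + _]addrC bracketPl -[bracket u y + _]addrC bracketPr.
by rewrite [RHS]addrACA addrC.
Qed.

Lemma ad_euler_basis (D : {linear B -> B}) u c :
  (forall a i, D (blockL a i) = ad_euler u c (blockL a i)) ->
  forall x, D x = ad_euler u c x.
Proof.
move=> EL; elim/block_ind => [|k x y IHx IHy|//]; first by rewrite linear0 ad_euler0.
by rewrite linearP ad_eulerP IHx IHy.
Qed.

Lemma bracket_L00 c (j : nat) :
  bracket (blockL 0 0%N) (blockL c j) = c%:~R *: blockL c j :> B.
Proof.
have e0 : c * 1%:Z - 0 * j.+1%:Z = c by rewrite mul0r subr0 mulr1.
by rewrite bracket_blockL e0 add0r.
Qed.

End Coefficients.

(** * Homogeneous components of a derivation *)

Lemma lincomb (F : pzRingType) (k l r x y : F) :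
  l = r -> x - y = k * (l - r) -> x = y.
Proof. by move=> -> /eqP; rewrite subrr mulr0 subr_eq0 => /eqP. Qed.

Lemma lincomb2 (F : pzRingType) (k l r k' l' r' x y : F) :
  l = r -> l' = r' -> x - y = k * (l - r) + k' * (l' - r') -> x = y.
Proof.
by move=> -> -> /eqP; rewrite !subrr !mulr0 addr0 subr_eq0 => /eqP.
Qed.

(** Here [psi c i] is the coefficient at [(c + a, i + b)] of the image of
    [L_(c, i)] under a derivation; [psiE] is the Leibniz rule on basis vectors,
    read in degree [(a, b)]. *)
Section HomogeneousComponents.
Variables (F : numFieldType) (a b : int) (psi : int -> nat -> F).
Hypothesis psiE : forall c (i : nat) d (j : nat),
  psi (c + d) (i + j)%N * (omega c i d j)%:~R
  = psi c i * (omega (c + a) (i%:Z + b) d j)%:~R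
    - psi d j * (omega (d + a) (j%:Z + b) c i)%:~R.

(** [ad L_(0, 0)] acts in degree [(a, b)] by the nonzero scalar [a], so the Leibniz
    rule with [L_(0, 0)] determines the component from [psi 0 0]. *)
Lemma component_shift c j : a != 0 ->
  psi c j = - psi 0 0%N / a%:~R * (omega a b c j)%:~R.
Proof.
move=> a0; have aF0 : a%:~R != 0 :> F by rewrite intr_eq0.
have := psiE 0 0 c j; rewrite !add0r !add0n => E.
apply: (mulIf aF0); rewrite [RHS]mulrAC divfK // mulNr.
have -> : psi c j * a%:~R =
  - (psi c j * (omega 0 0 c j)%:~R + psi c j * (omega (c + a) (j%:Z + b) 0 0)%:~R).
  rewrite -mulrDr -rmorphD /= -mulrN -rmorphN.
  by congr (_ * _%:~R); rewrite /omega; ring.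
by rewrite E subrK.
Qed.

(** For [d != 0] the Leibniz rule with [L_(0, i)] makes [psi d j] affine in [j], of
    a slope [g] independent of [d].  Reaching [L_(0, n)] also as a bracket of
    [L_(1, n)] and [L_(-1, 0)] gives a second formula for [psi 0 n]; the two are
    compatible only if [g = 0], because [b != 0].  So [psi] depends on the first
    index only, and the Leibniz rule with [L_(1, 0)], written at levels [0] and
    [1], makes it linear. *)
Lemma component_vertical c j : a = 0 -> b != 0 ->
  (b < 0 -> forall c, psi c 0%N = 0) -> psi c j = c%:~R * psi 1 0%N.
Proof.
move=> a0 b0 neg; have bF0 : b%:~R != 0 :> F by rewrite intr_eq0.
pose f := b%:~R : F.
have E c1 i d k :
  psi (c1 + d) (i + k)%N * (d%:~R * (i%:R + 1) - c1%:~R * (k%:R + 1))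
   = psi c1 i * (d%:~R * (i%:R + f + 1) - c1%:~R * (k%:R + 1)) +
     psi d k * (d%:~R * (i%:R + 1) - c1%:~R * (k%:R + f + 1)).
  have := psiE c1 i d k; rewrite a0 !addr0 /omega.
  rewrite !(rmorphB, rmorphD, rmorphM) /= => ->; rewrite /f; ring.
have H1 d i k : d != 0 ->
    psi d (i + k)%N * (i%:R + 1) = psi 0 i * (i%:R + f + 1) + psi d k * (i%:R + 1).
  move=> d0; have dF0 : d%:~R != 0 :> F by rewrite intr_eq0.
  have := E 0 i d k; rewrite add0r => H.
  by apply: (mulIf dF0); apply: (lincomb (k := 1) H); ring.
have H2 n : psi 0 n * (n%:R + 2) = (n%:R + 2 + f) * (psi 1 n + psi (-1) 0%N).
  by have := E 1 n (-1) 0%N; rewrite addn0 => H; apply: (lincomb (k := -1) H); ring.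
have [g Hg] : exists g, forall d k, d != 0 -> psi d k = psi d 0%N + k%:R * g.
  exists (psi 0 1%N * (2 + f) / 2) => d k d0; elim: k => [|k IH].
    by rewrite mul0r addr0.
  have := H1 d 1%N k d0; rewrite add1n => H; rewrite -natr1 mulrDl addrA -IH.
  by apply: (lincomb (k := 2^-1) H); field.
(* For negative [b] nothing lies below level [0]; otherwise [H2] at [n = 0]
   applies, where [f + 2] is nonzero. *)
pose s := psi 1 0%N + psi (-1) 0%N.
have s0 : s = 0.
  have [bneg|bpos] := ltP b 0; first by rewrite /s !neg // addr0.
  have fpos : 0 <= f by rewrite ler0z.
  have p0 : psi 0 0%N = 0.
    have H := E 0 0%N 1 0%N; rewrite add0r add0n in H.
    apply: (mulIf (_ : f + 1 != 0)); first by rewrite gt_eqF // ltr_wpDl.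
    by apply: (lincomb (k := -1) H); ring.
  have H := H2 0%N; rewrite p0 -/s in H.
  apply: (mulIf (_ : f + 2 != 0)); first by rewrite gt_eqF // ltr_wpDl.
  by apply: (lincomb (k := -1) H); ring.
have H3 n : psi 0 n * (n%:R + 2) = (n%:R + 2 + f) * (n%:R * g).
  by rewrite H2 Hg //; congr (_ * _); rewrite addrAC -/s s0 add0r.
have H4 n : n%:R * g * (n%:R + 1) = psi 0 n * (n%:R + f + 1).
  have := H1 1 n 0%N isT; rewrite addn0 [psi 1 n]Hg // => H.
  by apply: (lincomb (k := 1) H); ring.
(* Eliminating [psi 0 n] gives [(n+1)(n+2) g = (n+1+f)(n+2+f) g]; for [n = 1]
   and [n = 2] the difference of the two relations is [2 f g = 0]. *)
have g0 : g = 0.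
  have K1 := H3 1%N; have K2 := H3 2%N; have L1 := H4 1%N; have L2 := H4 2%N.
  have M1 : g * 6 = g * ((3 + f) * (2 + f)).
    by apply: (lincomb2 (k := 2 + f) (k' := 3) K1 L1); ring.
  have M2 : g * 12 = g * ((4 + f) * (3 + f)).
    by apply: (lincomb2 (k := (3 + f) / 2) (k' := 2) K2 L2); field.
  apply: (mulIf bF0); apply: (mulIf (_ : 2 != 0)); first by rewrite pnatr_eq0.
  by rewrite -/f; apply: (lincomb2 (k := 1) (k' := -1) M1 M2); ring.
have p0 n : psi 0 n = 0.
  apply: (mulIf (_ : n%:R + 2 != 0)); first by rewrite -natrD pnatr_eq0 addn2.
  by rewrite H3 g0 !mulr0 mul0r.
have h d k : psi d k = psi d 0%N.
  by have [->|d0] := eqVneq d 0; rewrite ?p0 // Hg // g0 mulr0 addr0.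
rewrite h.
have K0 := E c 0%N 1 0%N; have K1 := E c 1%N 1 0%N.
rewrite ![psi _ (_ + _)%N]h [psi c 1%N]h in K0 K1.
have K : psi (c + 1) 0%N = psi c 0%N + psi 1 0%N.
  by apply: (lincomb2 (k := -1) (k' := 1) K0 K1); ring.
rewrite K in K0; apply: (mulIf bF0); rewrite -/f.
by apply: (lincomb (k := -1) K0); ring.
Qed.

(** In degree [(0, 0)] the Leibniz rule says that [psi] is additive on pairs of
    indices with nonzero structure constant.  Such pairs connect everything to
    [(1, 0)] and [(0, 1)]; [omega] vanishes on [(1, 0), (1, 0)], so the value at
    [(2, 0)] is obtained from [(2, 0) + (-1, 0)]. *)
Lemma component_degree0 c j : a = 0 -> b = 0 ->
  psi c j = c%:~R * psi 1 0%N + j%:R * psi 0 1%N.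
Proof.
move=> a0 b0.
have E c1 (i : nat) d (k : nat) : omega c1 i d k != 0 ->
    psi (c1 + d) (i + k)%N = psi c1 i + psi d k.
  move=> nz; have nzF : (omega c1 i d k)%:~R != 0 :> F by rewrite intr_eq0.
  have := psiE c1 i d k; rewrite a0 b0 !addr0 => H.
  apply: (mulIf nzF); rewrite H mulrDl; congr (_ + _); rewrite -mulrN -rmorphN.
  by congr (_ * _%:~R); rewrite /omega opprB.
have E0 d e (k : nat) : d != e * (k%:Z + 1) -> psi (e + d) k = psi e 0%N + psi d k.
  by move=> ne; have := E e 0%N d k; rewrite add0n; apply; rewrite /omega; lia.
have p0 : psi 0 0%N = 0.
  by have /eqP := E0 1 0 0%N isT; rewrite add0r -subr_eq subrr => /eqP.
have pN1 : psi (-1) 0%N = - psi 1 0%N.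
  by have /eqP := E0 1 (-1) 0%N isT; rewrite addNr p0 eq_sym addr_eq0 => /eqP.
have pS d : psi (d + 1) 0%N = psi d 0%N + psi 1 0%N.
  have [->|d1] := eqVneq d 1; last first.
    by rewrite addrC [in RHS]addrC; apply: E0; rewrite add0r mulr1.
  have := E0 (1 + 1) (-1) 0%N isT.
  have -> : -1 + (1 + 1) = 1 :> int by [].
  by rewrite pN1 => H; apply: (addrI (- psi 1 0%N)); rewrite -H addKr.
have pl d : psi d 0%N = d%:~R * psi 1 0%N.
  elim/int_ind: d => [|n IH|n IH]; first by rewrite p0 mul0r.
    by rewrite -addn1 PoszD pS IH rmorphD mulrDl mul1r.
  apply: (addIr (psi 1 0%N)); rewrite -pS.
  have -> : - n.+1%:Z + 1 = - n%:Z by lia.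
  rewrite IH -[in LHS](subrK 1 (- n%:Z)) rmorphD mulrDl mul1r.
  by congr (_%:~R * _ + _); lia.
have pc d k : psi d k = d%:~R * psi 1 0%N + psi 0 k.
  have [->|d0] := eqVneq d 0; first by rewrite mul0r add0r.
  by rewrite -pl -E0 ?addr0 //; lia.
rewrite pc; congr (_ + _); elim: j => [|n IH]; first by rewrite p0 mul0r.
have := E 0 1%N 1 n isT; rewrite add0r add1n pc [psi 1 n]pc addrCA => /addrI ->.
by rewrite IH -natr1 mulrDl mul1r addrC.
Qed.
End HomogeneousComponents.

(** * Every derivation has the form [ad u + c E] *)

Section Assembly.
Variable R : realType.
Local Notation B := (block R).

Lemma block_of_fun (S : {fset (int * nat)%type}) (f : int * nat -> R[i]) :
  (forall p, p \notin S -> f p = 0) -> exists v : B, forall p, v@_p = f p.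
Proof.
move=> f0; exists [malg p in S => f p] => p.
by rewrite mcoeffE; case: ifPn => // /f0 ->.
Qed.

(** If every component of nonzero degree is a multiple of the corresponding inner
    one, the multipliers are the coefficients of a single [v].  They are read off
    the images of [L_(0, 0)] and [L_(1, 0)], hence finitely many are nonzero. *)
Lemma inner_up_to_diagonal (D : {linear B -> B}) :
  (forall c (j : nat) (a b : int), b < 0 ->
     coefz (D (blockL c j)) (c + a) (j%:Z + b) = 0) ->
  (forall (a : int) (b : nat), ~~ ((a == 0) && (b == 0)%N) ->
     exists l, forall c (j : nat),
     coefz (D (blockL c j)) (c + a) (j%:Z + b) = l * (omega a b c j)%:~R) ->
  exists v : B, forall c (j : nat),
    D (blockL c j)
    = bracket v (blockL c j) + coefz (D (blockL c j)) c j *: blockL c j.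
Proof.
move=> neg inner.
(* [omega a b 0 0 = - a], and [omega 0 b 1 0 = b + 1] serves when [a = 0]. *)
pose lam (p : int * nat) : R[i] :=
  if p.1 == 0 then
    if p.2 == 0%N then 0 else coefz (D (blockL 1 0)) 1 p.2 / (p.2.+1)%:R
  else - coefz (D (blockL 0 0)) p.1 p.2 / p.1%:~R.
have [|v vE] := @block_of_fun (msupp (D (blockL 0 0)) `|`
    [fset (0 : int, p.2) | p in msupp (D (blockL 1 0))])%fset lam.
  move=> [a b]; rewrite in_fsetU negb_or => /andP[n0 n1]; rewrite /lam /=.
  have [a0|_] := eqVneq a 0; last by rewrite coefz_nat mcoeff_outdom // oppr0 mul0r.
  have [//|_] := eqVneq b 0%N.
  rewrite coefz_nat mcoeff_outdom; first by rewrite mul0r.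
  by apply: contra n1 => i1; rewrite a0; apply/imfsetP; exists (1, b).
exists v => c j; apply: coefz_ext => a n.
rewrite coefzD coefzZ coefz_bracketL coefzL.
have [b bE] : exists b, b = n%:Z - j%:Z by exists (n%:Z - j%:Z).
have [d dE] : exists d, d = a - c by exists (a - c).
have -> : a = c + d by lia.
have -> : n%:Z = j%:Z + b by lia.
have -> : c + d - c = d by lia.
have -> : j%:Z + b - j%:Z = b by lia.
case: b bE => [b|b] bE; last first.
  rewrite neg // [coefz v _ _]coefz_neg // mul0r add0r.
  have -> : (j%:Z == j%:Z + Negz b) = false by lia.
  by rewrite andbF mulr0.
have [/andP[/eqP-> /eqP->]|nz] := boolP ((d == 0) && (b == 0)%N).
  by rewrite coefz_nat vE /lam /= mul0r add0r !addr0 !eqxx mulr1.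
have -> : (c == c + d) && (j%:Z == j%:Z + b%:Z) = false by lia.
have [l lE] := inner _ _ nz; rewrite lE mulr0 addr0 coefz_nat vE /lam; congr (_ * _).
rewrite [(d, b).1]/= [(d, b).2]/=.
have L0 := lE 0 0%N; have L1 := lE 1 0%N; rewrite !add0r in L0 L1.
have [d0|d0] := eqVneq d 0.
  have b0 : b != 0%N by move: nz; rewrite d0.
  rewrite (negbTE b0); rewrite d0 addr0 in L1; rewrite L1.
  have -> : omega 0 b 1 0%N = b.+1%:Z by rewrite /omega; lia.
  by rewrite -pmulrn mulfK // pnatr_eq0.
rewrite L0; have -> : omega d b 0 0 = - d by rewrite /omega; lia.
by rewrite rmorphN mulrN opprK mulfK // intr_eq0.
Qed.

Lemma Der_ad_euler (D : {linear B -> B}) : Der R D ->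
  exists u c, forall x, D x = ad_euler u c x.
Proof.
move=> DD.
pose psi a b c (j : nat) := coefz (D (blockL c j)) (c + a) (j%:Z + b).
have psiE a b c (i : nat) d (j : nat) :
    psi a b (c + d) (i + j)%N * (omega c i d j)%:~R
    = psi a b c i * (omega (c + a) (i%:Z + b) d j)%:~R
      - psi a b d j * (omega (d + a) (j%:Z + b) c i)%:~R.
  have := DD (blockL c i) (blockL d j); rewrite bracket_blockL linearZ /=.
  move/(congr1 (fun x => coefz x (c + d + a) (i%:Z + j%:Z + b))).
  rewrite coefzZ coefzD [bracket _ (D _)]bracketC.
  rewrite -scaleN1r coefzZ mulN1r !coefz_bracketL.
  have -> : c + d + a - d = c + a by lia.
  have -> : c + d + a - c = d + a by lia.
  have -> : i%:Z + j%:Z + b - j%:Z = i%:Z + b by lia.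
  have -> : i%:Z + j%:Z + b - i%:Z = j%:Z + b by lia.
  rewrite /psi PoszD => <-; rewrite [LHS]mulrC; congr (_%:~R * _).
  by rewrite /omega; lia.
have neg0 a b c : b < 0 -> psi a b c 0%N = 0.
  by move=> b0; rewrite /psi coefz_neg // add0r.
have [|a b nz|v vE] := inner_up_to_diagonal (D := D).
- move=> c j a b b0; rewrite -/(psi a b c j).
  have [a0|a0] := eqVneq a 0; last first.
    by rewrite (component_shift (psiE a b)) // neg0 // oppr0 !mul0r.
  rewrite (component_vertical (psiE a b)) //; first by rewrite neg0 ?mulr0.
    by rewrite lt_eqF.
  by move=> _ d; exact: neg0.
- have [a0|a0] := eqVneq a 0; last first.
    exists (- psi a b 0 0%N / a%:~R) => c j.
    by rewrite -/(psi a b c j) (component_shift (psiE a b)).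
  exists (psi a b 1 0%N / b.+1%:R) => c j; rewrite -/(psi a b c j).
  rewrite (component_vertical (psiE a b)) //; last by move: nz; rewrite a0.
  have -> : omega a b c j = c * b.+1%:Z by rewrite a0 /omega; lia.
  by rewrite intrM -pmulrn mulrCA divfK 1?mulrC // pnatr_eq0.
pose r := psi 0 0 1 0%N; pose s := psi 0 0 0 1%N.
exists (v + r *: blockL 0 0%N), s; apply: ad_euler_basis => c j.
rewrite vE ad_eulerE -[v + _]addrC bracketPl bracket_L00.
rewrite euler_blockL addrAC [RHS]addrC.
congr (_ + _).
have -> : coefz (D (blockL c j)) c j = r * c%:~R + s * j%:R.
  rewrite (mulrC r) (mulrC s).
  have := component_degree0 (psiE 0 0) c j erefl erefl.
  rewrite {1}/psi !addr0; exact: id.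
by rewrite scalerDl -2!scalerA.
Qed.
End Assembly.

(** * Local derivations: components of nonzero degree *)

(** A way to let [s] tend to [0] in an identity that holds for [s != 0] only. *)
Lemma horner0_of_const (F : numFieldType) (p : {poly F}) k :
  (forall s, s != 0 -> p.[s] = k) -> p.[0] = k.
Proof.
move=> pk; apply/eqP; rewrite -subr_eq0 -[X in _ - X](hornerC k 0) -hornerN -hornerD.
suff -> : p - k%:P = 0 by rewrite horner0.
pose q := p - k%:P; apply/eqP; rewrite -/q.
apply: contraT => q0.
have := max_poly_roots (rs := [seq n.+1%:R | n <- iota 0 (size q)]) q0.
rewrite size_map size_iota ltnn; apply.
  apply/allP => _ /mapP[n _ ->]; rewrite rootE /q hornerD hornerN hornerC.
  by rewrite pk ?subrr // pnatr_eq0.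
by rewrite map_inj_uniq ?iota_uniq // => m n /eqP; rewrite eqr_nat => /eqP[].
Qed.

(** The sequence [u] may depend on [s] and so may its length.  Beyond [N] the
    recurrence is homogeneous and [al] does not vanish, so [u], which is eventually
    zero, vanishes from [N] on; solving downwards from there expresses [u n] as a
    polynomial in [s] that is the same for all [s]. *)
Lemma ray_solution (F : fieldType) (al be x y : nat -> F) (N : nat) :
  (forall n, al n != 0) ->
  (forall n, (N <= n)%N -> x n = 0) -> (forall n, (N <= n)%N -> y n = 0) ->
  forall n, exists2 p : {poly F}, p.[0] = x n / al n &
    forall s (u : nat -> F), (exists K, forall m, (K <= m)%N -> u m = 0) ->
    (forall m, al m * u m + s * (be m * u m.+1) = x m + s * y m) -> u n = p.[s].
Proof.
move=> al0 xN yN.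
suff H k n : (N <= k + n)%N -> exists2 p : {poly F}, p.[0] = x n / al n &
    forall s (u : nat -> F), (exists K, forall m, (K <= m)%N -> u m = 0) ->
    (forall m, al m * u m + s * (be m * u m.+1) = x m + s * y m) -> u n = p.[s].
  by move=> n; apply: (H N); rewrite leq_addr.
elim: k n => [|k IH] n; last first.
  rewrite addSnnS => /IH[p _ pE].
  exists ((al n)^-1 *: ((x n)%:P + 'X * ((y n)%:P - be n *: p))) => [|s u uK ur].
    by rewrite hornerZ hornerD hornerM hornerX hornerC mul0r addr0 mulrC.
  rewrite !(hornerZ, hornerD, hornerM, hornerX, hornerC, hornerN) -(pE s u) //.
  by rewrite mulrBr addrA -ur addrK mulKf.
rewrite add0n => Nn; exists 0 => [|s u [K uK] ur].
  by rewrite horner0 xN // mul0r.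
rewrite horner0.
suff H k m : (K <= k + m)%N -> (N <= m)%N -> u m = 0.
  by apply: (H K) => //; rewrite leq_addr.
elim: k m => [|k IHk] m; first by move=> /uK.
rewrite addSnnS => /IHk {}IHk Nm; have := ur m.
rewrite xN // yN // IHk ?(leq_trans Nm) // !mulr0 !addr0.
by move/eqP; rewrite mulf_eq0 (negbTE (al0 m)) => /eqP.
Qed.

Section Local.
Variable R : realType.
Local Notation B := (block R).
Variable Delta : {linear B -> B}.
Hypothesis Delta_local : forall x, exists u c, Delta x = ad_euler u c x.

Lemma local_component_coef c (j : nat) (a b : int) : ~~ ((a == 0) && (b == 0)) ->
  exists u : B,
    coefz (Delta (blockL c j)) (c + a) (j%:Z + b) = coefz u a b * (omega a b c j)%:~R.
Proof.
move=> nz; have [u [e ->]] := Delta_local (blockL c j); exists u.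
rewrite coefz_ad_eulerL; have -> : c + a - c = a by lia.
have -> : j%:Z + b - j%:Z = b by lia.
have -> : (c == c + a) && (j%:Z == j%:Z + b) = false by lia.
by rewrite !mulr0 addr0.
Qed.

Lemma local_component_neg c (j : nat) (a b : int) : b < 0 ->
  coefz (Delta (blockL c j)) (c + a) (j%:Z + b) = 0.
Proof.
move=> b0; have [|u ->] := @local_component_coef c j a b; first by lia.
by rewrite coefz_neg // mul0r.
Qed.

(** Test on [X + s Y] with [X = L_(g, k)] and [Y = L_(c, j)].  If
    [Delta (X + s Y) = [u, X + s Y] + e E (X + s Y)], the coefficients of [u] along
    the ray [(a, b) + n (g - c, k - j)] satisfy a two-term recurrence.  As [k] exceeds
    [j + b], the ray leaves the index set backwards, so the coefficient of
    [Delta (X + s Y)] at [Y + (a, b)] involves only the start of the ray: it says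
    that [u] has at [(a, b)] the coefficient on the right-hand side, for every
    [s != 0].  The recurrence makes that coefficient a polynomial in [s] with
    constant term the left-hand side. *)
Lemma local_component_ratio g (k : nat) c (j : nat) (a : int) (b : nat) :
  ~~ ((a == 0) && (b == 0)%N) -> (j + b < k)%N -> omega a b c j != 0 ->
  (k.+1 * `|omega a b c j| < `|(g * j.+1%:Z - c * k.+1%:Z)%R|)%N ->
  coefz (Delta (blockL g k)) (g + a) (k%:Z + b%:Z) / (omega a b g k)%:~R
  = coefz (Delta (blockL c j)) (c + a) (j%:Z + b%:Z) / (omega a b c j)%:~R.
Proof.
move=> nz jk om0 big.
set X := blockL g k; set Y := blockL c j.
pose pa (n : nat) := a + n%:Z * (g - c).
pose pb (n : nat) := b%:Z + n%:Z * (k%:Z - j%:Z).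
pose al n := omega (pa n) (pb n) g k; pose be n := omega (pa n.+1) (pb n.+1) c j.
pose x n := coefz (Delta X) (g + pa n) (k%:Z + pb n).
pose y n := coefz (Delta Y) (g + pa n) (k%:Z + pb n).
(* Up to the term [k.+1 * omega a b c j], too small to be a nonzero multiple of
   the determinant [g * j.+1 - c * k.+1], the integer [j.+1 * al n] is a multiple
   of that determinant. *)
have al0 n : al n != 0.
  have E : j.+1%:Z * al n = (g * j.+1%:Z - c * k.+1%:Z) * (b.+1%:Z - n%:Z * j.+1%:Z)
      + k.+1%:Z * omega a b c j.
    rewrite /al /omega /pa /pb (intS j) (intS k) (intS b); ring.
  apply/eqP => al0; move: E; rewrite al0 mulr0 => /esym/eqP.
  rewrite addr_eq0 => /eqP/(congr1 absz); rewrite abszN !abszM absz_nat => E.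
  have [q0|q0] := posnP `|(b.+1%:Z - n%:Z * j.+1%:Z)%R|%N.
    move: E; rewrite q0 muln0 => /esym/eqP; rewrite muln_eq0 /= absz_eq0.
    by rewrite (negbTE om0).
  by move: big; rewrite -E ltnNge leq_pmulr.
have alF0 n : (al n)%:~R != 0 :> R[i] by rewrite intr_eq0.
have pbn n : n%:Z <= pb n by rewrite /pb; nia.
have vanish Z : exists N : nat, forall n, (N <= n)%N ->
    coefz (Delta Z) (g + pa n) (k%:Z + pb n) = 0.
  have [K KP] := coefz_bound (Delta Z); exists K.+1 => n Kn.
  apply/eqP; apply: contraT.
  by move/KP => [_]; have := pbn n; lia.
have [Nx xN] := vanish X; have [Ny yN] := vanish Y.
have [p p0 pE] := @ray_solution _ (fun n => (al n)%:~R) (fun n => (be n)%:~R) x y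
  (maxn Nx Ny) alF0 (fun n nN => xN n (leq_trans (leq_maxl _ _) nN))
  (fun n nN => yN n (leq_trans (leq_maxr _ _) nN)) 0%N.
have x0 : x 0%N = coefz (Delta X) (g + a) (k%:Z + b%:Z).
  by rewrite /x /pa /pb !mul0r !addr0.
have al00 : al 0%N = omega a b g k by rewrite /al /pa /pb !mul0r !addr0.
move: p0; rewrite x0 al00 => <-.
apply: horner0_of_const => s s0.
have [u [e uE]] := Delta_local (s *: Y + X).
have coefzE a' b' : s * coefz (Delta Y) a' b' + coefz (Delta X) a' b'
   = s * coefz (ad_euler u e Y) a' b' + coefz (ad_euler u e X) a' b'.
  move: uE; rewrite linearP ad_eulerP.
  by move/(congr1 (fun z => coefz z a' b')); rewrite 2!coefzP.
have pu : coefz u a b = p.[s].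
  have -> : coefz u a b = coefz u (pa 0%N) (pb 0%N) by rewrite /pa /pb !mul0r !addr0.
  apply: (pE s (fun n => coefz u (pa n) (pb n))).
    have [K KP] := coefz_bound u; exists K.+1 => n Kn.
    apply/eqP; apply: contraT.
    by move/KP => [_]; have := pbn n; lia.
  move=> n; cbv beta; rewrite /x /y [RHS]addrC coefzE.
  rewrite (coefz_ad_eulerL u e c j) (coefz_ad_eulerL u e g k).
  have -> : (c == g + pa n) && (j%:Z == k%:Z + pb n) = false.
    by have := pbn n; lia.
  have -> : (g == g + pa n) && (k%:Z == k%:Z + pb n) = false.
    by move: nz; rewrite /pa /pb; case: n => [|n]; nia.
  have -> : g + pa n - g = pa n by lia.
  have -> : k%:Z + pb n - k%:Z = pb n by lia.
  have -> : g + pa n - c = pa n.+1 by rewrite /pa; lia.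
  have -> : k%:Z + pb n - j%:Z = pb n.+1 by rewrite /pb; lia.
  rewrite !mulr0 !addr0 [RHS]addrC; congr (_ + s * _); exact: mulrC.
have omF0 : (omega a b c j)%:~R != 0 :> R[i] by rewrite intr_eq0.
rewrite -pu; apply: (mulfI s0); apply: (mulIf omF0); rewrite -!mulrA mulVf // mulr1.
have := coefzE (c + a) (j%:Z + b%:Z).
rewrite (coefz_ad_eulerL u e c j) (coefz_ad_eulerL u e g k).
have -> : coefz (Delta X) (c + a) (j%:Z + b%:Z) = 0.
  have -> : c + a = g + (c + a - g) by lia.
  have -> : j%:Z + b%:Z = k%:Z + (j%:Z + b%:Z - k%:Z) by lia.
  by apply: local_component_neg; lia.
have -> : (c == c + a) && (j%:Z == j%:Z + b%:Z) = false by lia.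
have -> : (g == c + a) && (k%:Z == j%:Z + b%:Z) = false by lia.
have -> : c + a - c = a by lia.
have -> : j%:Z + b%:Z - j%:Z = b%:Z by lia.
rewrite [coefz u (c + a - g) _]coefz_neg; last by lia.
by rewrite !mulr0 mul0r !addr0 => ->.
Qed.

(** Two basis vectors with nonzero [omega] are compared through a third one,
    [L_(g, k)], far enough from both. *)
Lemma local_component (a : int) (b : nat) : ~~ ((a == 0) && (b == 0)%N) ->
  exists l, forall c (j : nat),
    coefz (Delta (blockL c j)) (c + a) (j%:Z + b) = l * (omega a b c j)%:~R.
Proof.
move=> nz.
have [c0 om0] : exists c0 : int, omega a b c0 0%N != 0.
  have [a0|a0] := eqVneq a 0; first by exists 1; rewrite /omega a0; lia.
  by exists 0; rewrite /omega; lia.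
exists (coefz (Delta (blockL c0 0)) (c0 + a) (0%N%:Z + b)
  / (omega a b c0 0%N)%:~R) => c j.
have [omj0|omj] := eqVneq (omega a b c j) 0.
  have [|u ->] := @local_component_coef c j a b; first by lia.
  by rewrite omj0 !mulr0.
pose k := (j + b).+1.
pose g := (k.+1 * (`|omega a b c j| + `|omega a b c0 0%N| + `|c| + `|c0|)).+1.
rewrite -(local_component_ratio (g := g) (k := k)) //; last 2 first.
- by rewrite /k; lia.
- by rewrite /g; nia.
rewrite (local_component_ratio (c := c) (j := j)) ?divfK ?intr_eq0 //.
by rewrite /k; lia.
Qed.

Lemma local_up_to_diagonal : exists v : B, forall c (j : nat),
  Delta (blockL c j)
    = bracket v (blockL c j) + coefz (Delta (blockL c j)) c j *: blockL c j.
Proof. exact: inner_up_to_diagonal local_component_neg local_component. Qed.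

End Local.

(** * Local derivations: the component of degree zero *)

Lemma not_multiple (x d m : int) : x != 0 -> (`|x| < `|d|)%N -> x != m * d.
Proof.
move=> x0 xd; apply/eqP => E; move: xd; rewrite E abszM.
have [m0|m0] := eqVneq m 0; first by move: x0; rewrite E m0 mul0r eqxx.
by nia.
Qed.

(** A finitely supported solution of a two-term recurrence vanishes as long as, when
    coming from minus infinity, the leading coefficients do not. *)
Lemma line_zero_below (F : idomainType) (al be v : int -> F) (k : int) :
  (exists K : nat, forall n : int, v n != 0 -> (`|n| <= K)%N) ->
  (forall n : int, n < k -> al n != 0) ->
  (forall n : int, n < k -> al n * v n + be n * v (n - 1) = 0) ->
  forall n : int, n < k -> v n = 0.
Proof.
move=> [K vK] al0 rec.
have H (m : nat) n : n < m%:Z - K%:Z -> n < k -> v n = 0.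
  elim: m n => [|m IH] n nm nk.
    by apply/eqP; apply: contraT => /vK; lia.
  have := rec n nk; rewrite (IH (n - 1)); try lia.
  by rewrite mulr0 addr0 => /eqP; rewrite mulf_eq0 (negbTE (al0 n nk)) => /eqP.
by move=> n; apply: (H (`|n| + K).+1); lia.
Qed.

Lemma line_zero_above (F : idomainType) (al be v : int -> F) (k : int) :
  (exists K : nat, forall n : int, v n != 0 -> (`|n| <= K)%N) ->
  (forall n : int, k < n -> be n != 0) ->
  (forall n : int, k < n -> al n * v n + be n * v (n - 1) = 0) ->
  forall n : int, k <= n -> v n = 0.
Proof.
move=> [K vK] be0 rec n kn.
rewrite -(opprK n).
apply: (@line_zero_below _ (fun m => be (1 - m)) (fun m => al (1 - m))
  (fun m => v (- m)) (1 - k)); last by lia.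
- by exists K => m /vK; lia.
- by move=> m mk; apply: be0; lia.
move=> m mk; rewrite addrC; have -> : - (m - 1) = 1 - m by lia.
have km : k < 1 - m by lia.
by have := rec _ km; have -> : 1 - m - 1 = - m by lia.
Qed.

Lemma ad_eulerD4 (R : realType) (u : block R) c (x y z w : block R) :
  ad_euler u c (x + y + (z + w))
  = ad_euler u c x + ad_euler u c y + (ad_euler u c z + ad_euler u c w).
Proof. by rewrite !ad_eulerD. Qed.

Lemma coefzD4 (R : realType) (x y z w : block R) a b :
  coefz (x + y + (z + w)) a b
  = coefz x a b + coefz y a b + (coefz z a b + coefz w a b).
Proof. by rewrite !coefzD. Qed.

(** The map [L_(a, i) |-> phi a i *: L_(a, i)] is a local derivation.  Negative [b]
    is harmless in [phi_local]: both sides are then zero. *)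
Section DegreeZero.
Variables (R : realType) (phi : int -> nat -> R[i]).
Local Notation B := (block R).
Hypothesis phi_local : forall x : B, exists u c, forall a b,
  coefz (ad_euler u c x) a b = phi a `|b|%N * coefz x a b.

Lemma phi_origin : phi 0 0%N = 0.
Proof.
have [u [e E]] := phi_local (blockL 0 0%N); move: (E 0 0).
rewrite (coefz_ad_eulerL u e 0 0%N) coefzL !eqxx => H; rewrite -[LHS]mulr1 -[LHS]H.
have -> : omega (0 - 0) (0 - 0%N%:Z) 0 0%N = 0 by rewrite /omega; lia.
by rewrite mul0r !mulr0 addr0.
Qed.

(** Test on [L_(c, i) + L_(c', i')].  Only the coefficients of [u] on the line of
    multiples of [(c' - c, i' - i)] matter, and collinearity turns the structure
    constants along it into [c - m (c' - c)] and [c - (m - 2) (c' - c)].  As none of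
    these vanishes, [u] has on this line the coefficient at the origin only; the
    latter and [e] then give [phi c i] and [phi c' i'], and [e] drops out of the
    cross product. *)
Lemma phi_collinear (c : int) (i : nat) (c' : int) (i' : nat) :
  c * i'%:Z = c' * i%:Z ->
  (forall m : int, c != m * (c' - c)) -> phi c i * c'%:~R = phi c' i' * c%:~R.
Proof.
move=> col nd.
pose d : int := c' - c; pose f : int := i'%:Z - i%:Z.
have [d0|d0] := eqVneq d 0.
  have c0 : c != 0 by have := nd 0; rewrite mul0r.
  have cc : c' = c by move: d0; rewrite /d; lia.
  have /(mulfI c0) [->] : c * i'%:Z = c * i%:Z by rewrite col cc.
  by rewrite cc.
have K : c * f = d * i%:Z by rewrite /f /d mulrBr mulrBl col.
have K' : c' * f = d * i'%:Z by rewrite /f /d mulrBr mulrBl -col.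
have [u [e E]] := phi_local (blockL c i + blockL c' i').
pose v (m : int) := coefz u (m * d) (m * f).
pose al (m : int) := omega (m * d) (m * f) c i.
pose be (m : int) := omega ((m - 1) * d) ((m - 1) * f) c' i'.
have alE (m : int) : al m = c - m * d.
  by apply: (lincomb (k := m) K); rewrite /al /omega; ring.
have beE (m : int) : be m = c - (m - 2) * d.
  have -> : c = c' - d by rewrite /d; lia.
  by apply: (lincomb (k := m - 1) K'); rewrite /be /omega; ring.
have rec (m : int) : (al m)%:~R * v m + (be m)%:~R * v (m - 1)
    = (phi c i - e * i%:R) * (m == 0)%:R + (phi c' i' - e * i'%:R) * (m == 1)%:R.
  have := E (c + m * d) (i%:Z + m * f).
  rewrite ad_eulerD 2!coefzD.
  rewrite (coefz_ad_eulerL u e c i) (coefz_ad_eulerL u e c' i') !coefzL.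
  have m1 : (m == 1) = (m - 1 == 0) by lia.
  have -> : (c == c + m * d) && (i%:Z == i%:Z + m * f) = (m == 0).
    have [->|nz] := eqVneq m 0; first by rewrite !mul0r !addr0 !eqxx.
    by have := mulf_neq0 nz d0; lia.
  have -> : (c' == c + m * d) && (i'%:Z == i%:Z + m * f) = (m == 1).
    have [->|nz] := eqVneq m 1; first by rewrite !mul1r /d /f; lia.
    have nz1 : m - 1 != 0 by lia.
    have := mulf_neq0 nz1 d0; rewrite mulrBl mul1r /d; lia.
  have -> : c + m * d - c = m * d by lia.
  have -> : i%:Z + m * f - i%:Z = m * f by lia.
  have -> : c + m * d - c' = (m - 1) * d by rewrite mulrBl mul1r /d; lia.
  have -> : i%:Z + m * f - i'%:Z = (m - 1) * f by rewrite mulrBl mul1r /f; lia.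
  rewrite -/(al m) -/(be m) -/(v m) -/(v (m - 1)).
  have [->|nz] := eqVneq m 0.
    rewrite !mul0r !addr0 absz_nat !mulr0 !mulr1 !addr0 => H.
    by apply: (lincomb (k := 1) H); rewrite pmulrn; ring.
  have [->|nz1] := eqVneq m 1.
    have -> : c + 1 * d = c' by rewrite /d; lia.
    have -> : i%:Z + 1 * f = i'%:Z by rewrite /f; lia.
    rewrite !mulr0 !add0r !mulr1 absz_nat !addr0 => H.
    by apply: (lincomb (k := 1) H); rewrite pmulrn; ring.
  rewrite !mulr0 !addr0 mulr0 => H; rewrite -[RHS]H; ring.
have vK : exists K : nat, forall n : int, v n != 0 -> (`|n| <= K)%N.
  have [N NP] := coefz_bound u; exists N => n /NP [+ _]; rewrite abszM.
  by apply: leq_trans; rewrite leq_pmulr // absz_gt0.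
have vneg : v (-1) = 0.
  apply: (line_zero_below (k := 0) vK (al := fun m => (al m)%:~R)
    (be := fun m => (be m)%:~R)) => // n n0.
    by rewrite intr_eq0 alE subr_eq0 nd.
  rewrite rec; have -> : (n == 0) = false by lia.
  have -> : (n == 1) = false by lia.
  by rewrite !mulr0 addr0.
have vpos : v 1 = 0.
  apply: (line_zero_above (k := 1) vK (al := fun m => (al m)%:~R)
    (be := fun m => (be m)%:~R)) => // n n0.
    by rewrite intr_eq0 beE subr_eq0 nd.
  rewrite rec; have -> : (n == 0) = false by lia.
  have -> : (n == 1) = false by lia.
  by rewrite !mulr0 addr0.
have r0 := rec 0; have r1 := rec 1.
rewrite vpos subrr alE beE /= !(mulr0, mul0r, subr0, add0r, addr0, mulr1) in r0 r1.
rewrite vneg mulr0 addr0 in r0.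
have b1 : be 1 = c' by rewrite beE /d; lia.
rewrite b1 in r1.
have colF : c%:~R * i'%:R = c'%:~R * i%:R :> R[i].
  by rewrite !pmulrn -!rmorphM col.
have -> : phi c i = c%:~R * v 0 + e * i%:R by rewrite r0 subrK.
have -> : phi c' i' = c'%:~R * v 0 + e * i'%:R by rewrite r1 subrK.
by apply: (lincomb (k := - e) colF); ring.
Qed.

(** The indices [c] and [1] may violate the divisibility condition of
    [phi_collinear]; both are compared with a large [N] instead. *)
Lemma phi_level0 c : phi c 0%N = c%:~R * phi 1 0%N.
Proof.
have [->|c0] := eqVneq c 0; first by rewrite phi_origin mul0r.
pose N := (`|c|.*2 + 3)%N.
have N0 : N%:~R != 0 :> R[i] by rewrite intr_eq0; lia.
have E1 : phi c 0%N * N%:~R = phi N 0%N * c%:~R.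
  by apply: phi_collinear => [|m]; [lia | apply: not_multiple; lia].
have E2 : phi 1 0%N * N%:~R = phi N 0%N * 1%:~R.
  by apply: phi_collinear => [|m]; [lia | apply: not_multiple; lia].
by apply: (mulIf N0); apply: (lincomb2 (k := 1) (k' := - c%:~R) E1 E2); ring.
Qed.

Lemma phi_diagonal (n : nat) : (0 < n)%N -> phi n n = n%:R * phi 1 1%N.
Proof.
move=> n0; pose N := (n.*2 + 3)%N.
have N0 : N%:~R != 0 :> R[i] by rewrite intr_eq0; lia.
have E1 : phi n n * N%:~R = phi N N * n%:~R.
  by apply: phi_collinear => [|m]; [lia | apply: not_multiple; lia].
have E2 : phi 1 1%N * N%:~R = phi N N * 1%:~R.
  by apply: phi_collinear => [|m]; [lia | apply: not_multiple; lia].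
apply: (mulIf N0); apply: (lincomb2 (k := 1) (k' := - n%:~R) E1 E2).
by rewrite (pmulrn _ n); ring.
Qed.

(** Test on [L_(M, 0) + L_(M + d, 0) + L_(c, j) + L_(c', j)], with [d] much larger
    than [M], and [M] larger than [c] and [c'] in absolute value.  At level [0]
    only the first two terms matter; by finiteness, [u] vanishes there outside the
    class of [M] modulo [d].  Hence at level [j], in the classes of [c] and of [c']
    modulo [d], the bracket with [u] comes only from level [j] of [u] and the first
    two terms.  As no structure constant involved is zero, such a bracket cannot be
    a nonzero multiple of one basis vector: [phi c j = e j], and likewise for
    [c']. *)
Lemma phi_level_const (c c' : int) (j : nat) : (forall a, phi a 0%N = 0) ->
  (0 < j)%N -> phi c j = phi c' j.
Proof.
move=> phi0 j0.
have [->//|cc'] := eqVneq c c'.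
pose M := (`|c| + `|c'|).+1; pose d := (M * (j + 5))%N.
pose X : B := blockL M 0%N; pose Y : B := blockL (M%:Z + d%:Z) 0%N.
pose Z : B := blockL c j; pose Z' : B := blockL c' j.
have [u [e E]] := phi_local (X + Y + (Z + Z')).
have d0 : d%:Z != 0 by rewrite /d /M; lia.
have E' (x b : int) : coefz u (x - M%:Z) b * (omega (x - M%:Z) b M 0)%:~R
    + coefz u (x - M%:Z - d%:Z) b * (omega (x - M%:Z - d%:Z) b (M%:Z + d%:Z) 0)%:~R
    + (coefz u (x - c) (b - j%:Z) * (omega (x - c) (b - j%:Z) c j)%:~R
    + coefz u (x - c') (b - j%:Z) * (omega (x - c') (b - j%:Z) c' j)%:~R)
    = (phi x `|b|%N - e * b%:~R) * (((M%:Z == x) && (0 == b))%:R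
      + ((M%:Z + d%:Z == x) && (0 == b))%:R
      + (((c == x) && (j%:Z == b))%:R + ((c' == x) && (j%:Z == b))%:R)).
  have := E x b; rewrite ad_eulerD4 2!coefzD4 /X /Y /Z /Z' !coefz_ad_eulerL !coefzL.
  have -> : x - (M%:Z + d%:Z) = x - M%:Z - d%:Z by lia.
  have -> : b - 0%N%:Z = b by lia.
  by move=> H; apply: (lincomb (k := 1) H); ring.
have bound (t b : int) : exists K : nat, forall n : int,
    coefz u (t + n * d%:Z) b != 0 -> (`|n| <= K)%N.
  have [K KP] := coefz_bound u; exists (K + `|t|)%N => n /KP [+ _].
  by nia.
have u0 (t : int) : (forall n : int, M%:Z - t != n * d%:Z) -> coefz u t 0 = 0.
  move=> nt.
  have := @line_zero_below _ (fun n => (M%:Z - (t + n * d%:Z))%:~R)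
    (fun n => (omega (t + (n - 1) * d%:Z) 0 (M%:Z + d%:Z) 0)%:~R)
    (fun n => coefz u (t + n * d%:Z) 0) 1 (bound t 0) _ _ 0 isT.
  rewrite mul0r addr0; apply.
    by move=> n _; rewrite intr_eq0; have := nt n; lia.
  move=> n _ /=.
  have := E' (M%:Z + t + n * d%:Z) 0.
  have -> : M%:Z + t + n * d%:Z - M%:Z = t + n * d%:Z by lia.
  have -> : t + n * d%:Z - d%:Z = t + (n - 1) * d%:Z by lia.
  rewrite ![coefz u _ (0 - j%:Z)]coefz_neg; try lia.
  rewrite absz0 phi0 !mul0r !addr0 !mulr0 subr0 mul0r mulrC => <-.
  have -> : omega (t + n * d%:Z) 0 M 0 = M%:Z - (t + n * d%:Z).
    by rewrite /omega; lia.
  by congr (_ + _); exact: mulrC.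
have key (z z' : int) : z != z' -> (`|z| + `|z'| < M)%N ->
  (forall x b : int, b = j%:Z ->
    coefz u (x - M%:Z) b * (omega (x - M%:Z) b M 0)%:~R
    + coefz u (x - M%:Z - d%:Z) b * (omega (x - M%:Z - d%:Z) b (M%:Z + d%:Z) 0)%:~R
    + (coefz u (x - z) (b - j%:Z) * (omega (x - z) (b - j%:Z) z j)%:~R
    + coefz u (x - z') (b - j%:Z) * (omega (x - z') (b - j%:Z) z' j)%:~R)
    = (phi x j - e * j%:R) * ((z == x)%:R + (z' == x)%:R)) -> phi z j = e * j%:R.
  move=> zz' zM Ez.
  pose v (n : int) := coefz u (z - M%:Z + n * d%:Z) j.
  pose al (n : int) : int := omega (z - M%:Z + n * d%:Z) j M 0.
  pose be (n : int) : int := omega (z - M%:Z + (n - 1) * d%:Z) j (M%:Z + d%:Z) 0.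
  have rec (n : int) : (al n)%:~R * v n + (be n)%:~R * v (n - 1)
     = (phi z j - e * j%:R) * (n == 0)%:R.
    have := Ez (z + n * d%:Z) j erefl; rewrite subrr.
    rewrite (u0 (z + n * d%:Z - z)); last first.
      move=> m; have -> : (M%:Z - (z + n * d%:Z - z) == m * d%:Z)
         = (M%:Z == (m + n) * d%:Z) by lia.
      by apply: not_multiple; rewrite /d; lia.
    rewrite (u0 (z + n * d%:Z - z')); last first.
      move=> m; have -> : (M%:Z - (z + n * d%:Z - z') == m * d%:Z)
         = (M%:Z + (z' - z) == (m + n) * d%:Z) by lia.
      by apply: not_multiple; rewrite /d; lia.
    have -> : z + n * d%:Z - M%:Z = z - M%:Z + n * d%:Z by lia.
    have -> : z - M%:Z + n * d%:Z - d%:Z = z - M%:Z + (n - 1) * d%:Z by lia.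
    have -> : (z' == z + n * d%:Z) = false.
      have -> : (z' == z + n * d%:Z) = (z' - z == n * d%:Z) by lia.
      by apply/negbTE/not_multiple; rewrite /d; lia.
    have -> : (z == z + n * d%:Z) = (n == 0).
      have [->|n0] := eqVneq n 0; first by rewrite mul0r addr0 eqxx.
      by have := mulf_neq0 n0 d0; lia.
    rewrite !mul0r !addr0 -/(v n) -/(v (n - 1)) -/(al n) -/(be n).
    have [->|n0] := eqVneq n 0; last by rewrite !mulr0 mulrC [v (n - 1) * _]mulrC.
    by rewrite mul0r addr0 mulrC [v (0 - 1) * _]mulrC.
  have nz (m : int) : M%:Z * (j%:Z + 2) - z != m * d%:Z.
    by apply: not_multiple; rewrite /d; nia.
  have al0 (n : int) : al n != 0.
    by have := nz n; rewrite /al /omega; lia.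
  have be0 (n : int) : be n != 0.
    have := nz (n - (j%:Z + 2)); rewrite /be /omega; lia.
  have vK := bound (z - M%:Z) j.
  have vneg : v (-1) = 0.
    apply: (line_zero_below (k := 0) vK (al := fun m => (al m)%:~R)
      (be := fun m => (be m)%:~R)) => // n n0; first by rewrite intr_eq0.
    rewrite rec; have -> : (n == 0) = false by lia.
    by rewrite mulr0.
  have v0 : v 0 = 0.
    apply: (line_zero_above (k := 0) vK (al := fun m => (al m)%:~R)
      (be := fun m => (be m)%:~R)) => // n n0; first by rewrite intr_eq0.
    rewrite rec; have -> : (n == 0) = false by lia.
    by rewrite mulr0.
  have := rec 0; rewrite v0 add0r vneg !mulr0 addr0 mulr1 => /esym/eqP.
  by rewrite subr_eq0 => /eqP.
have Ej (x b : int) : b = j%:Z ->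
    (M%:Z == x) && (0 == b) = false /\
    (M%:Z + d%:Z == x) && (0 == b) = false.
  by move=> ->; lia.
rewrite (key c c') // => [|x b bj]; last first.
  have [e1 e2] := Ej x b bj; rewrite E' e1 e2 bj eqxx !andbT absz_nat.
  by rewrite -pmulrn !add0r.
rewrite (key c' c) // => [||x b bj]; [by rewrite eq_sym|by rewrite addnC|].
have [e1 e2] := Ej x b bj.
rewrite [X in _ + X = _]addrC E' e1 e2 bj eqxx !andbT absz_nat.
by rewrite -pmulrn !add0r [_ + (c == x)%:R]addrC.
Qed.

End DegreeZero.

(** * The theorem *)

Lemma coefz_bracket_L00 (R : realType) (x : block R) a b :
  coefz (bracket (blockL 0 0%N) x) a b = a%:~R * coefz x a b.
Proof.
elim/block_ind: x => [|k x y IHx IHy|c j].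
- by rewrite bracket0r !coefz0 mulr0.
- by rewrite bracketPr 2!coefzP IHx IHy mulrDr mulrCA.
rewrite bracket_L00 coefzZ coefzL.
by have [->|] := eqVneq c a; rewrite ?mulr0.
Qed.

Lemma ad_euler_shift (R : realType) (u v : block R) k c x :
  ad_euler (k *: v + u) c x = ad_euler u c x + k *: bracket v x.
Proof. by rewrite !ad_eulerE bracketPl -addrA addrC. Qed.

(** After subtraction of a multiple of [ad L_(0, 0)], [phi] vanishes at level [0] and
    is constant on each other level, where the diagonal gives its value. *)
Lemma degree0_linear (R : realType) (phi : int -> nat -> R[i]) :
  (forall x : block R, exists u c, forall a b,
     coefz (ad_euler u c x) a b = phi a `|b|%N * coefz x a b) ->
  exists r s, forall c (j : nat), phi c j = r * c%:~R + s * j%:R.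
Proof.
move=> loc; set r := phi 1 0%N.
pose phi' c j := phi c j - r * c%:~R.
have loc' (x : block R) : exists u c, forall a b,
    coefz (ad_euler u c x) a b = phi' a `|b|%N * coefz x a b.
  have [u [c E]] := loc x; exists (- r *: blockL 0 0%N + u), c => a b.
  rewrite ad_euler_shift coefzD coefzZ coefz_bracket_L00 E.
  by rewrite /phi' mulrBl mulrA !mulNr.
have phi'0 c : phi' c 0%N = 0 by rewrite /phi' (phi_level0 loc) mulrC subrr.
exists r, (phi' 1 1%N) => c j.
apply/eqP; rewrite addrC -subr_eq; apply/eqP; rewrite -/(phi' c j).
case: j => [|j]; first by rewrite phi'0 mulr0.
rewrite (phi_level_const loc' c j.+1%:Z phi'0 (ltn0Sn j)).
by rewrite (phi_diagonal loc') // mulrC.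
Qed.

Lemma local_ad_euler (R : realType) (Delta : {linear block R -> block R}) :
  (forall x, exists u c, Delta x = ad_euler u c x) ->
  exists u c, forall x, Delta x = ad_euler u c x.
Proof.
move=> loc; have [v vE] := local_up_to_diagonal loc.
pose phi c (j : nat) := coefz (Delta (blockL c j)) c j.
have [x|r [s phiE]] := @degree0_linear R phi.
  have [u [c uE]] := loc x; exists (-1 *: v + u), c => a b.
  rewrite ad_euler_shift -uE scaleN1r coefzB.
  elim/block_ind: x {uE} => [|k x y IHx IHy|d j].
  - by rewrite linear0 bracket0r !coefz0 subrr mulr0.
  - rewrite linearP bracketPr 3!coefzP opprD addrACA -mulrBr IHx IHy mulrDr.
    by rewrite mulrCA.
  rewrite vE coefzD addrAC subrr add0r coefzZ coefzL.
  case: eqVneq => [->|_]; rewrite ?mulr0 //.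
  by case: eqVneq => [<-|_]; rewrite ?mulr0.
exists (r *: blockL 0 0%N + v), s; apply: ad_euler_basis => c j.
rewrite ad_euler_shift vE -/(phi c j) phiE bracket_L00 ad_eulerE euler_blockL.
by rewrite scalerDl -2!scalerA [LHS]addrA [LHS]addrAC.
Qed.

Theorem theorem1p1 (R : realType) : LDer R = Der R.
Proof.
apply/seteqP; split=> [Delta loc|D DD x]; last by exists D.
have [x|u [c uE]] := @local_ad_euler R Delta.
  have [D DD ->] := loc x; have [u [c uE]] := Der_ad_euler DD.
  by exists u, c; rewrite uE.
exact: ad_euler_Der uE.
Qed.
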